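(* For all integers $k\ge 0$ and $n\ge k+2$, $$\sum_{l=0}^{k+1}\left\{{n+1\atop n-l+1}\right\}_{n-k}\widehat c_{n-l}^{(-k)}=0.$$
   Context: For an integer $k$, the poly-Cauchy numbers of the second kind $\widehat c_n^{(k)}$ are defined by $\mathrm{Lif}_k(-\log(1+x))=\sum_{n\ge0}\widehat c_n^{(k)}x^n/n!$, where $\mathrm{Lif}_k(z)=\sum_{m\ge0}\frac{z^m}{m!(m+1)^k}$; thus $\widehat c_n^{(-k)}$ uses $\mathrm{Lif}_{-k}(z)=\sum_{m\ge0}\frac{(m+1)^k z^m}{m!}$. For $r\ge 0$, the $r$-Stirling number of the second kind $\left\{{n\atop m}\right\}_r$ is the number of ways to partition $\{1,\dots,n\}$ into $m$ nonempty disjoint blocks such that $1,\dots,r$ lie in distinct blocks; equivalently $\left\{{n\atop m}\right\}_r=0$ for $n<r$, $\left\{{r\atop m}\right\}_r=\delta_{m,r}$, and $\left\{{n\atop m}\right\}_r=m\left\{{n-1\atop m}\right\}_r+\left\{{n-1\atop m-1}\right\}_r$ for $n>r$. *)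

(* Defs.v *)
From HB Require Import structures.
From mathcomp Require Import all_boot all_order all_algebra.
Set Implicit Arguments. Unset Strict Implicit. Unset Printing Implicit Defensive.
Import Order.TTheory GRing.Theory Num.Theory.
Local Open Scope ring_scope.

(* A formal power series over rat is represented by its coefficient sequence
   nat -> rat. The definition below gives the substitution f(g(x)) when
   g 0 = 0: its n-th coefficient depends only on f and g modulo x^(n+1). *)
Definition fps_comp (f g : nat -> rat) (n : nat) : rat :=
  ((\poly_(i < n.+1) f i) \Po (\poly_(i < n.+1) g i))`_n.

(* log(1 + x) = \sum_(n >= 1) (-1)^(n-1) x^n / n *)
Definition log1p_coef (n : nat) : rat :=
  if n is n'.+1 then (-1) ^+ n' / n'.+1%:R else 0.

(* The power of m + 1 has an integer exponent, so that k may be negative. *)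
Definition Lif_coef (k : int) (m : nat) : rat :=
  (m`!%:R * m.+1%:R ^ k)^-1.

(* Lif_k(- log(1 + x)) = \sum_n (polyCauchy2 k n) x^n / n! *)
Definition polyCauchy2 (k : int) (n : nat) : rat :=
  n`!%:R * fps_comp (Lif_coef k) (fun i => - log1p_coef i) n.

(* {1, ..., n} is represented by 'I_n, i standing for i + 1, so {1, ..., r}
   becomes the set of i < r; the number is 0 by convention when n < r. *)
Definition rStirling2 (r n m : nat) : nat :=
  #|[set P : {set {set 'I_n}} |
     [&& (r <= n)%N, partition P [set: 'I_n], #|P| == m &
         [forall i : 'I_n, forall j : 'I_n,
            (i < j < r)%N ==> (pblock P i != pblock P j)]]]|.

(* Main.v *)
(** Since (- log(1 + x))^m / m! generates (-1)^m times the signed Stirling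
    numbers s(n, m), polyCauchy2 (- k) n is the value at the falling factorial
    polynomial (t)_n of the linear form L sending t^m to (-1)^m (m + 1)^k, and
    L p is the value at t = -1 of the k-th iterate of p |-> (t p)' at p.
    Counting by kernels the maps {1, ..., n} -> {1, ..., x} that are injective
    on {1, ..., r} gives sum_m {n, m}_r (x)_m = (x)_r x^(n - r). Putting
    x = t + 1 and cancelling t + 1 turns this into
    sum_j {n + 1, j + 1}_(r + 1) (t)_j = (t)_r (t + 1)^(n - r). For
    r = n - k - 1 the right-hand side vanishes to order k + 1 at t = -1,
    so L annihilates it. *)

Require Import Defs.
From HB Require Import structures.
From mathcomp Require Import all_boot all_order all_algebra.
From mathcomp Require Import ring.
Set Implicit Arguments. Unset Strict Implicit. Unset Printing Implicit Defensive.
Import Order.TTheory GRing.Theory Num.Theory.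
Local Open Scope ring_scope.

(** * Counting maps by their kernels *)

(** A map is the pair of its restrictions to the first r and the last q points; the first must be
    injective and the second is free. *)
Lemma card_ffun_inj_prefix (r q : nat) (Y : finType) :
  #|[set f : {ffun 'I_(r + q) -> Y} |
     [forall i : 'I_(r + q), forall j : 'I_(r + q),
        (i < j < r)%N ==> (f i != f j)]]| = (#|Y| ^_ r * #|Y| ^ q)%N.
Proof.
pose h (f : {ffun 'I_(r + q) -> Y}) :=
  ([ffun i => f (lshift q i)], [ffun i => f (rshift r i)]).
have h_inj : injective h.
  move=> f g [/ffunP efg1 /ffunP efg2]; apply/ffunP=> i.
  case: (split_ordP i) => j ->; first by have := efg1 j; rewrite !ffunE.
  by have := efg2 j; rewrite !ffunE.
rewrite -(card_imset _ h_inj) -[in RHS](card_ord r) -card_inj_ffuns.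
rewrite -[in (_ ^ q)%N](card_ord q) -card_ffun -cardsT -cardsX.
apply: eq_card => -[f1 f2]; rewrite !inE andbT.
apply/imsetP/injectiveP => [[f] | f1_inj].
  rewrite inE => /'forall_forallP f_inj [-> _] i j; rewrite !ffunE => eq_fij.
  apply: val_inj; case: (ltngtP i j) => //= lt_ij.
    have /implyP := f_inj (lshift q i) (lshift q j).
    by rewrite /= lt_ij ltn_ord eq_fij eqxx => /(_ isT).
  have /implyP := f_inj (lshift q j) (lshift q i).
  by rewrite /= lt_ij ltn_ord eq_fij eqxx => /(_ isT).
exists [ffun i => match split i with inl j => f1 j | inr j => f2 j end].
  rewrite inE; apply/'forall_forallP => i j; apply/implyP; rewrite !ffunE.
  case: (split_ordP i) => i' ->; case: (split_ordP j) => j' -> /=.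
  - move=> /andP[lt_ij _]; apply/eqP => /f1_inj eq_ij.
    by rewrite eq_ij ltnn in lt_ij.
  - by rewrite andbF.
  - by rewrite andbT ltnNge (leq_trans (ltnW (ltn_ord j'))) ?leq_addr.
  - by rewrite andbF.
congr (_, _); apply/ffunP=> i; rewrite !ffunE.
  case: (split_ordP (lshift q i)) => j /eqP; last by rewrite eq_lrshift.
  by rewrite (inj_eq (@lshift_inj _ _)) => /eqP->.
case: (split_ordP (rshift r i)) => j /eqP; first by rewrite eq_rlshift.
by rewrite (inj_eq (@rshift_inj _ _)) => /eqP->.
Qed.

(** A map with kernel [P] is an injective map on the blocks of [P], composed with the projection to
    blocks. *)
Lemma card_ffun_kernel (T Y : finType) (P : {set {set T}}) :
  partition P [set: T] ->
  #|[set f : {ffun T -> Y} | preim_partition f [set: T] == P]| = #|Y| ^_ #|P|.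
Proof.
move=> partP; have [/eqP covP trivP P0] := and3P partP.
have blockP x : pblock P x \in P by rewrite pblock_mem // covP inE.
have blockE (x y : T) : (y \in pblock P x) = (pblock P x == pblock P y).
  by rewrite eq_pblock // covP inE.
(* Blocks become a finite type, so that maps out of them are finite functions; choosing a point in
   each block gives a section of [block]. *)
pose block x : {B | B \in P} := Sub (pblock P x) (blockP x).
have neB (B : {B | B \in P}) : exists x, x \in val B.
  by apply/set0Pn; apply: contraNneq P0 => <-; apply: valP.
have block_xchoose B : block (xchoose (neB B)) = B.
  by apply: val_inj; apply: def_pblock (valP B) (xchooseP (neB B)).
pose h (g : {ffun {B | B \in P} -> Y}) := [ffun x => g (block x)].
have h_inj : injective h.
  move=> g1 g2 /ffunP eg; apply/ffunP=> B.
  by have := eg (xchoose (neB B)); rewrite !ffunE block_xchoose.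
have <- : #|{: {B | B \in P}}| = #|P| := card_sig _.
rewrite -card_inj_ffuns -(card_imset _ h_inj).
apply: eq_card => f; rewrite inE.
apply/eqP/imsetP => [defP | [g]].
  have fE x y : (f x == f y) = (pblock P x == pblock P y).
    rewrite -blockE -defP pblock_equivalence_partition ?inE //.
    by move=> u v w _ _ _; split=> // /eqP->.
  exists [ffun B => f (xchoose (neB B))].
    rewrite inE; apply/injectiveP => B C; rewrite !ffunE => /eqP.
    rewrite fE => /eqP eqBC.
    by rewrite -(block_xchoose B) -(block_xchoose C); apply: val_inj.
  apply/ffunP=> x; rewrite !ffunE; apply/eqP; rewrite fE.
  by have /(congr1 val) /= -> := block_xchoose (block x).
rewrite inE => /injectiveP g_inj ->.
rewrite -[RHS](equivalence_partition_pblock partP).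
apply: eq_in_imset => x _; apply/setP=> y; rewrite !inE !ffunE blockE.
by rewrite (inj_eq g_inj).
Qed.

Lemma sum_rStirling2_ffact (r n x : nat) : (r <= n)%N ->
  (\sum_(m < n.+1) rStirling2 r n m * x ^_ m)%N = (x ^_ r * x ^ (n - r))%N.
Proof.
move=> le_rn; rewrite -(subnKC le_rn) addKn.
move: (n - r)%N => q; rewrite -{2 3}(card_ord x) -card_ffun_inj_prefix.
set F := [set f | _].
(* Injectivity on the first r points depends only on the kernel; [A] selects the kernels that can
   occur. *)
pose A (P : {set {set 'I_(r + q)}}) :=
  partition P [set: 'I_(r + q)] &&
  [forall i : 'I_(r + q), forall j : 'I_(r + q),
     (i < j < r)%N ==> (pblock P i != pblock P j)].
have FA (f : {ffun 'I_(r + q) -> 'I_x}) :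
    (f \in F) = A (preim_partition f [set: 'I_(r + q)]).
  rewrite inE /A preim_partitionP /=.
  apply: eq_forallb => i; apply: eq_forallb => j; congr (_ ==> ~~ _).
  have /and3P[/eqP cov triv _] := preim_partitionP f [set: 'I_(r + q)].
  rewrite eq_pblock ?cov ?inE // pblock_equivalence_partition ?inE //.
  by move=> u v w _ _ _; split=> // /eqP->.
have szP P : A P -> (#|P| < (r + q).+1)%N.
  case/andP=> partP _; have := card_partition partP.
  rewrite cardsT card_ord ltnS => defn.
  rewrite [leqRHS]defn -sum1_card; apply: leq_sum => B PB.
  rewrite lt0n cards_eq0.
  by have /and3P[_ _] := partP; apply: contraNneq => <-.
rewrite -[RHS]sum1_card.
pose ker (f : {ffun 'I_(r + q) -> 'I_x}) :=
  preim_partition f [set: 'I_(r + q)].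
rewrite (partition_big ker A) /=; last by move=> f; rewrite FA.
rewrite (eq_bigr (fun P : {set {set 'I_(r + q)}} => x ^_ #|P|)%N); last first.
  move=> P AP; have /andP[partP _] := AP.
  rewrite -[in RHS](card_ord x) -card_ffun_kernel // sum1_card.
  apply: eq_card => f; rewrite inE unfold_in /= FA /ker.
  by case: eqP => [->|_]; rewrite ?AP ?andbF.
(* By [szP], [inord] returns the true number of blocks whenever [A P] holds. *)
pose sz (P : {set {set 'I_(r + q)}}) : 'I_(r + q).+1 := inord #|P|.
rewrite (partition_big sz xpredT) //=.
apply: eq_bigr => m _; rewrite /rStirling2 -sum1_card big_distrl /=.
apply: eq_big => [P | P]; rewrite inE leq_addr /= ?mul1n.
  rewrite /A -andbA [(#|P| == m) && _]andbC; case partP: (partition P _) => //=.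
  case: forallP => //= distP; rewrite /sz; apply/eqP/eqP => [-> | <-].
    exact: inord_val.
  by rewrite inordK // szP // /A partP; apply/forallP.
by case/and3P=> _ /eqP->.
Qed.

(** * Falling factorials and powers of the logarithm *)

Definition falling_poly (n : nat) : {poly rat} := \prod_(i < n) ('X - i%:R%:P).

Lemma falling_polyS n : falling_poly n.+1 = falling_poly n * ('X - n%:R%:P).
Proof. by rewrite /falling_poly big_ord_recr. Qed.

Lemma size_falling_poly n : size (falling_poly n) = n.+1.
Proof. by rewrite size_prod_XsubC /index_enum -enumT size_enum_ord. Qed.

Lemma falling_poly_nat n x : (falling_poly n).[x%:R] = (x ^_ n)%:R.
Proof.
elim: n => [|n IHn]; first by rewrite /falling_poly big_ord0 hornerC.
rewrite falling_polyS hornerM IHn hornerXsubC ffactnSr natrM.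
have [le_nx | lt_xn] := leqP n x; first by rewrite natrB.
by rewrite ffact_small // !mul0r.
Qed.

Lemma falling_poly_shift n :
  falling_poly n.+1 \Po ('X + 1) = ('X + 1) * falling_poly n.
Proof.
rewrite /falling_poly rmorph_prod big_ord_recl /= subr0 comp_polyX.
congr (_ * _); apply: eq_bigr => i _.
rewrite rmorphB /= comp_polyX comp_polyC /bump /= natrD polyCD.
by rewrite opprD addrA addrK.
Qed.

Definition neg_log1p_poly (N : nat) : {poly rat} :=
  \poly_(i < N) - log1p_coef i.

(** This is (1 + x) (- log(1 + x))' = -1; truncation affects only the coefficients from degree [N]
    on. *)
Lemma coef_one_plus_X_deriv_neg_log1p N i : (i < N)%N ->
  ((1 + 'X) * (neg_log1p_poly N.+1)^`())`_i = - (i == 0)%:R.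
Proof.
move=> lt_iN; rewrite mulrDl mul1r coefD coefXM !coef_deriv !coef_poly.
rewrite !ltnS lt_iN.
case: i lt_iN => [|i] lt_iN /=; first by rewrite expr0 divr1 mulr1n addr0.
rewrite (ltnW lt_iN) oppr0 -[X in X + _]mulr_natr -[X in _ + X]mulr_natr exprS.
by rewrite !mulNr !divfK ?pnatr_eq0 // mul1r opprK subrr.
Qed.

Lemma coefM_const_mod (R : nzRingType) (p q : {poly R}) (n : nat) (c : R) :
  (forall i, (i <= n)%N -> q`_i = c *+ (i == 0)%N) -> (p * q)`_n = p`_n * c.
Proof.
move=> qE; rewrite coefM big_ord_recr /= subnn qE // big1 ?add0r // => i _.
by rewrite qE ?leq_subr // subn_eq0 leqNgt ltn_ord mulr0n mulr0.
Qed.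

(* The recurrence in n comes from (1 + x) (g^i)' = - i g^(i-1) modulo x^N,
   where g is the truncation of - log(1 + x). *)
Lemma coef_neg_log1p_exp N n i : (n <= N)%N ->
  n`!%:R * (neg_log1p_poly N.+1 ^+ i)`_n =
  i`!%:R * (-1) ^+ i * (falling_poly n)`_i :> rat.
Proof.
elim: n i => [|n IHn] i lenN.
  rewrite mul1r /falling_poly big_ord0 -horner_coef0 horner_exp horner_coef0.
  rewrite coef_poly /= oppr0 expr0n coef1.
  by case: i => [|i]; rewrite ?mulr0 // !mulr1.
case: i => [|i].
  rewrite expr0 coef1 mulr0 /falling_poly big_ord_recl subr0.
  by rewrite coefXM eqxx mulr0.
pose g := neg_log1p_poly N.+1; rewrite -/g.
have rec : n.+1%:R * (g ^+ i.+1)`_n.+1 + n%:R * (g ^+ i.+1)`_n =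
           - i.+1%:R * (g ^+ i)`_n.
  have : ((1 + 'X) * (g ^+ i.+1)^`())`_n = - i.+1%:R * (g ^+ i)`_n.
    rewrite deriv_exp /= mulrnAr coefMn mulrA [_ * g^+ i]mulrC.
    rewrite (@coefM_const_mod _ _ _ _ (-1)).
      by rewrite -[LHS]mulr_natl; ring.
    move=> j lejn; rewrite coef_one_plus_X_deriv_neg_log1p.
      by rewrite mulNrn.
    exact: leq_ltn_trans lejn lenN.
  rewrite mulrDl mul1r coefD coefXM !coef_deriv => <-.
  case: n {IHn lenN} => [|n] /=; first by rewrite mul0r mul1r mulr1n.
  by rewrite !mulr_natl.
have -> : n.+1`!%:R * (g ^+ i.+1)`_n.+1 =
    - i.+1%:R * (n`!%:R * (g ^+ i)`_n) - n%:R * (n`!%:R * (g ^+ i.+1)`_n).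
  by rewrite [- _ * _]mulrCA -rec factS natrM; ring.
(* Up to the factor (i + 1)! (-1)^(i + 1), the two terms come from (t)_(n+1) = t (t)_n - n (t)_n. *)
rewrite /g !IHn ?(ltnW lenN) // falling_polyS mulrBr coefB coefMX coefMC /=.
by rewrite factS natrM exprS; ring.
Qed.

(** * The linear form and the poly-Cauchy numbers *)

(** Each t^i is an eigenvector of p |-> (t p)' with eigenvalue i + 1, whence the weights of
    Lif_(-k). *)
Lemma coef_iter_derivXM k (p : {poly rat}) i :
  (iter k (fun p => ('X * p)^`()) p)`_i = i.+1%:R ^+ k * p`_i.
Proof.
elim: k => [|k IHk]; first by rewrite mul1r.
by rewrite iterS coef_deriv coefXM /= IHk exprS -[LHS]mulr_natl mulrA.
Qed.

Definition cauchy_form k (p : {poly rat}) : rat :=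
  (iter k (fun p => ('X * p)^`()) p).[-1].

Lemma cauchy_formE k N (p : {poly rat}) : (size p <= N)%N ->
  cauchy_form k p = \sum_(i < N) i.+1%:R ^+ k * p`_i * (-1) ^+ i.
Proof.
move=> szp; rewrite /cauchy_form (@horner_coef_wide _ N); last first.
  apply/leq_sizeP => i leNi.
  by rewrite coef_iter_derivXM (leq_sizeP _ _ szp) ?mulr0.
by apply: eq_bigr => i _; rewrite coef_iter_derivXM.
Qed.

Lemma cauchy_form_sum k (I : finType) (a : I -> rat) (p : I -> {poly rat}) :
  cauchy_form k (\sum_i a i *: p i) = \sum_i a i * cauchy_form k (p i).
Proof.
rewrite /cauchy_form.
suff -> : iter k (fun p => ('X * p)^`()) (\sum_i a i *: p i) =
          \sum_i a i *: iter k (fun p => ('X * p)^`()) (p i).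
  by rewrite horner_sum; apply: eq_bigr => i _; rewrite hornerZ.
apply/polyP=> j; rewrite coef_iter_derivXM !coef_sum big_distrr.
by apply: eq_bigr => i _; rewrite /= !coefZ coef_iter_derivXM mulrCA.
Qed.

(** Each application of p |-> (t p)' lowers the order of vanishing at -1 by at most one, so after k
    of them a factor t + 1 is left. The cofactor [q] changes on the way, hence is general in the
    induction. *)
Lemma cauchy_form_exp_eq0 k (q : {poly rat}) :
  cauchy_form k (q * ('X + 1) ^+ k.+1) = 0.
Proof.
elim: k q => [|k IHk] q.
  by rewrite /cauchy_form /= hornerM hornerD hornerX hornerC addNr mulr0.
rewrite /cauchy_form iterSr.
set u := (_)^`().
suff -> : u = (('X * q)^`() * ('X + 1) + 'X * q *+ k.+2) * ('X + 1) ^+ k.+1.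
  exact: IHk.
rewrite /u mulrA derivM deriv_exp derivD derivX derivC addr0 mul1r /= exprS.
by rewrite -![_ * _ *+ _]mulr_natl; ring.
Qed.

Lemma polyCauchy2_cauchy_form k n :
  polyCauchy2 (- k%:Z) n = cauchy_form k (falling_poly n).
Proof.
rewrite (@cauchy_formE k n.+1) ?size_falling_poly // /polyCauchy2 /fps_comp.
have LifE m : Lif_coef (- k%:Z) m = m.+1%:R ^+ k / m`!%:R.
  by rewrite /Lif_coef -exprnN invfM invrK mulrC.
(* The leading coefficient of the truncated Lif is nonzero, so the composition is a sum of exactly n
   + 1 terms. *)
rewrite coef_comp_poly size_poly_eq; last first.
  by rewrite LifE mulf_neq0 ?invr_eq0 ?expf_neq0 ?pnatr_eq0 -?lt0n ?fact_gt0.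
rewrite big_distrr; apply: eq_bigr => i _ /=.
rewrite mulrCA coef_neg_log1p_exp // coef_poly ltn_ord LifE.
by field; rewrite pnatr_eq0 -lt0n fact_gt0.
Qed.

(** * Polynomial identities for r-Stirling numbers *)

Lemma poly_eq_nat (R : numDomainType) (p q : {poly R}) :
  (forall x : nat, p.[x%:R] = q.[x%:R]) -> p = q.
Proof.
move=> eqpq; apply/eqP; rewrite -subr_eq0; apply/eqP.
apply: (@roots_geq_poly_eq0 _ _ [seq x%:R | x <- iota 0 (size (p - q))]).
- by apply/allP=> _ /mapP[x _ ->]; rewrite rootE !hornerE eqpq subrr.
- by rewrite map_inj_uniq ?iota_uniq // => x y /eqP; rewrite eqr_nat => /eqP.
- by rewrite size_map size_iota.
Qed.

Lemma sum_rStirling2_falling_poly r n : (r <= n)%N ->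
  \sum_(m < n.+1) (rStirling2 r n m)%:R *: falling_poly m =
  falling_poly r * 'X^(n - r).
Proof.
move=> le_rn; apply: poly_eq_nat => x; rewrite horner_sum hornerM hornerXn.
rewrite falling_poly_nat -natrX -natrM -sum_rStirling2_ffact // natr_sum.
by apply: eq_bigr => m _; rewrite hornerZ falling_poly_nat -natrM.
Qed.

(** Pigeonhole: the first r elements already occupy r distinct blocks. *)
Lemma rStirling2_small r n m : (m < r)%N -> rStirling2 r n m = 0%N.
Proof.
move=> lt_mr; apply/eqP; rewrite cards_eq0; apply/eqP/setP => P; rewrite !inE.
apply/negbTE/and4P => -[le_rn partP /eqP cardP /'forall_forallP distP].
have [/eqP covP _ _] := and3P partP.
pose f (i : 'I_r) := pblock P (widen_ord le_rn i).
have f_inj : injective f.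
  move=> i j eq_f; apply: val_inj; case: (ltngtP i j) => //= lt_ij.
    have /implyP := distP (widen_ord le_rn i) (widen_ord le_rn j).
    by rewrite /= lt_ij ltn_ord -/(f i) -/(f j) eq_f eqxx => /(_ isT).
  have /implyP := distP (widen_ord le_rn j) (widen_ord le_rn i).
  by rewrite /= lt_ij ltn_ord -/(f i) -/(f j) eq_f eqxx => /(_ isT).
have : (#|f @: setT| <= #|P|)%N.
  apply/subset_leq_card/subsetP => _ /imsetP[i _ ->].
  by rewrite pblock_mem // covP inE.
by rewrite card_imset // cardsT card_ord cardP leqNgt lt_mr.
Qed.

Lemma sum_rStirling2_falling_polyS r n : (r <= n)%N ->
  \sum_(j < n.+1) (rStirling2 r.+1 n.+1 j.+1)%:R *: falling_poly j =
  falling_poly r * ('X + 1) ^+ (n - r).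
Proof.
move=> le_rn; have X1_neq0 : 'X + 1 != 0 :> {poly rat}.
  by rewrite -size_poly_eq0 size_XaddC.
apply: (mulfI X1_neq0); rewrite mulrA -falling_poly_shift.
have := @sum_rStirling2_falling_poly r.+1 n.+1 le_rn.
move/(congr1 (comp_poly ('X + 1))).
(* The term m = 0 lacks the factor t + 1, but its coefficient vanishes because 0 < r + 1. *)
rewrite big_ord_recl rStirling2_small // scale0r add0r subSS.
rewrite rmorphM rmorphXn /= comp_polyX => <-.
rewrite rmorph_sum big_distrr; apply: eq_bigr => j _ /=.
by rewrite comp_polyZ falling_poly_shift scalerAr.
Qed.

Theorem theorem8 (k n : nat) (hn : (k + 2 <= n)%N) :
  \sum_(0 <= l < k.+2)
     (rStirling2 (n - k) (n + 1) (n - l + 1))%:R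
       * polyCauchy2 (- k%:Z) (n - l) = 0 :> rat.
Proof.
pose r := (n - k.+1)%N.
have lt_kn : (k < n)%N by rewrite -addn1 (leq_trans _ hn) // leq_add2l.
have -> : (n - k = r.+1)%N by rewrite /r subnSK.
have defk : (n - r = k.+1)%N by rewrite subKn.
pose F j := (rStirling2 r.+1 n.+1 j.+1)%:R * cauchy_form k (falling_poly j).
have : \sum_(j < n.+1) F j = 0.
  rewrite -cauchy_form_sum sum_rStirling2_falling_polyS ?leq_subr // defk.
  exact: cauchy_form_exp_eq0.
(* The terms with j < r vanish since j + 1 < r + 1; the k + 2 terms from r to n remain. *)
rewrite -(big_mkord xpredT) (big_cat_nat (n := r)) ?leqW ?leq_subr //=.
rewrite [X in X + _]big_nat_cond big1 ?add0r => [|j]; last first.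
  by rewrite andbT => /andP[_ lt_jr]; rewrite /F rStirling2_small ?mul0r.
rewrite -[X in \sum_(X <= _ < _) _]add0n big_addn subSn ?leq_subr //.
(* The second 0 is the right-hand side of the goal; the first is the neutral element of the sum. *)
rewrite defk => {2}<-.
(* Reversing l turns n - l into l + r, as n = r + k + 1. *)
rewrite big_nat_rev; apply: eq_big_nat => l /andP[_ lt_lk].
have -> : (n - (0 + k.+2 - l.+1) = l + r)%N.
  by rewrite add0n subSS subnA // ?(ltnW lt_kn) // addnC.
by rewrite !addn1 polyCauchy2_cauchy_form.
Qed.
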